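(* For every integer $n\geq 1$, the semiring $S_c^*(a^n)$ is finitely based.
   Context: An ai-semiring (additively idempotent semiring) is an algebra $(S,+,\cdot)$ with two binary operations such that $(S,+)$ is a commutative idempotent semigroup, $(S,\cdot)$ is a semigroup, and both distributive laws hold. The signature is $(+,\cdot)$, with no constants. An algebra is finitely based if all its identities follow from some finite set of identities it satisfies; otherwise it is nonfinitely based. For $n\ge 1$, $S_c^*(a^n)$ is the ai-semiring with universe $\{a,a^2,\ldots,a^n,0\}$ (these $n+1$ elements distinct), where $0$ is absorbing for both operations ($0+s=s+0=0$ and $0\cdot s=s\cdot 0=0$ for all $s$), $a^i+a^j=a^{\max\{i,j\}}$, and $a^i a^j=a^{i+j}$ if $i+j\le n$, $a^ia^j=0$ if $i+j>n$. *)

(* Defs.v *)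
From mathcomp Require Import all_boot zify.
From Stdlib Require List.

Set Implicit Arguments.
Unset Strict Implicit.
Unset Printing Implicit Defensive.

(* Algebras of signature (+, ·): two binary operations, no constants, no laws. *)
Record algebra := Algebra {
  carrier :> Type;
  aadd : carrier -> carrier -> carrier;
  amul : carrier -> carrier -> carrier
}.

Definition is_ai_semiring (A : algebra) : Prop :=
  [/\ [/\ associative (@aadd A), commutative (@aadd A)
        & idempotent_op (@aadd A)],
      associative (@amul A),
      left_distributive (@amul A) (@aadd A)
    & right_distributive (@amul A) (@aadd A)].

(* Terms over countably many variables. *)
Inductive term : Type :=
  | Var of nat
  | Add of term & term
  | Mul of term & term.

Fixpoint eval (A : algebra) (v : nat -> A) (t : term) : A :=
  match t with
  | Var x => v x
  | Add t1 t2 => aadd (eval v t1) (eval v t2)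
  | Mul t1 t2 => amul (eval v t1) (eval v t2)
  end.

Definition identity : Type := (term * term)%type.

Definition satisfies (A : algebra) (e : identity) : Prop :=
  forall v : nat -> A, eval v e.1 = eval v e.2.

Definition models (A : algebra) (E : seq identity) : Prop :=
  forall e, List.In e E -> satisfies A e.

(* [B] ranges over all algebras of the signature, not only ai-semirings; the
   ai-semiring laws, when needed, have to be among (or follow from) [E]. *)
Definition follows_from (E : seq identity) (e : identity) : Prop :=
  forall B : algebra, models B E -> satisfies B e.

Definition finitely_based (A : algebra) : Prop :=
  exists E : seq identity,
    models A E /\ forall e, satisfies A e -> follows_from E e.

(* The universe {a, a^2, ..., a^n, 0}: [Some i] is a^(i+1), [None] is 0. *)
Definition sc_carrier (n : nat) : Type := option 'I_n.

Definition sc_add (n : nat) (x y : sc_carrier n) : sc_carrier n :=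
  match x, y with
  | Some i, Some j => Some (if i <= j then j else i)
  | _, _ => None
  end.

(* a^(i+1) a^(j+1) = a^((i+j+1)+1), and [insub k] is [None] when [n <= k]. *)
Definition sc_mul (n : nat) (x y : sc_carrier n) : sc_carrier n :=
  match x, y with
  | Some i, Some j => insub (i + j).+1
  | _, _ => None
  end.

Definition Sc_star (n : nat) : algebra := Algebra (@sc_add n) (@sc_mul n).

(* a^i for 1 <= i <= n. *)
Definition sc_pow (n i : nat) : Sc_star n := insub i.-1.

Lemma sc_add_pow (n i j : nat) : 1 <= i <= n -> 1 <= j <= n ->
  aadd (sc_pow n i) (sc_pow n j) = sc_pow n (maxn i j).
Proof.
case: i j => [|i] [|j] //= hi hj; rewrite /sc_pow maxnSS /=.
rewrite (insubT (fun k => k < n) hi) (insubT (fun k => k < n) hj) /=.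
by case: (leqP i j) => h /=; rewrite insubT /=.
Qed.

Lemma sc_mul_pow (n i j : nat) : 1 <= i <= n -> 1 <= j <= n ->
  amul (sc_pow n i) (sc_pow n j) =
  if i + j <= n then sc_pow n (i + j) else None.
Proof.
case: i j => [|i] [|j] //= hi hj; rewrite /sc_pow addSn addnS /=.
rewrite (insubT (fun k => k < n) hi) (insubT (fun k => k < n) hj) /=.
by case: ifP => [//|/negbT h]; rewrite insubN.
Qed.

(* Order embedding into nat, sending a^(i+1) to i and 0 to n. *)
Definition sc_nat (n : nat) (x : sc_carrier n) : nat :=
  if x is Some i then val i else n.

Lemma sc_nat_inj (n : nat) : injective (@sc_nat n).
Proof.
case=> [[i hi]|] [[j hj]|] //= h; first by congr Some; apply: val_inj.
- by exfalso; lia.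
- by exfalso; lia.
Qed.

Lemma sc_nat_add (n : nat) (x y : sc_carrier n) :
  sc_nat (sc_add x y) = maxn (sc_nat x) (sc_nat y).
Proof.
case: x y => [[i hi]|] [[j hj]|] /=; try lia.
by case: leqP => /=; lia.
Qed.

Lemma sc_nat_mul (n : nat) (x y : sc_carrier n) :
  sc_nat (sc_mul x y) = minn n (sc_nat x + sc_nat y).+1.
Proof.
case: x y => [[i hi]|] [[j hj]|] /=; try lia.
by case: insubP => [u hu /= ->|] /=; lia.
Qed.

Lemma Sc_star_ai_semiring (n : nat) : is_ai_semiring (Sc_star n).
Proof.
have E := (sc_nat_add, sc_nat_mul).
split; first split.
- by move=> x y z; apply: sc_nat_inj; rewrite /= !E; lia.
- by move=> x y; apply: sc_nat_inj; rewrite /= !E; lia.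
- by move=> x; apply: sc_nat_inj; rewrite /= !E; lia.
- by move=> x y z; apply: sc_nat_inj; rewrite /= !E; lia.
- by move=> x y z; apply: sc_nat_inj; rewrite /= !E; lia.
- by move=> x y z; apply: sc_nat_inj; rewrite /= !E; lia.
Qed.

(* Main.v *)
Require Import Defs.
From mathcomp Require Import all_boot zify.
From Stdlib Require List Classical.

Set Implicit Arguments.
Unset Strict Implicit.
Unset Printing Implicit Defensive.

(** A word w is below a term t in S_c^*(a^n) iff it is so under the valuations
    sending every variable outside w to the least element a. If all words of t
    have length at most n, then so has w, and a word u of t only matters through
    the positions in w of its letters, i.e. through one of boundedly many
    patterns. Keeping one word of t for each pattern, we get a valid inequality
    of bounded size implying the given one. If t contains a word of length
    greater than n, then t is the top element 0. Hence the valid identities of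
    size bounded in terms of n, finitely many up to renaming, form a basis. *)

(** * Size, variables and renaming of terms *)

Fixpoint leaves (t : term) : nat :=
  match t with
  | Var _ => 1
  | Add t1 t2 | Mul t1 t2 => leaves t1 + leaves t2
  end.

Fixpoint vars (t : term) : seq nat :=
  match t with
  | Var x => [:: x]
  | Add t1 t2 | Mul t1 t2 => vars t1 ++ vars t2
  end.

Fixpoint rename (f : nat -> nat) (t : term) : term :=
  match t with
  | Var x => Var (f x)
  | Add t1 t2 => Add (rename f t1) (rename f t2)
  | Mul t1 t2 => Mul (rename f t1) (rename f t2)
  end.

Lemma leaves_gt0 t : 0 < leaves t.
Proof. by elim: t => //= t1 h1 t2 h2; rewrite addn_gt0 h1. Qed.

Lemma size_vars t : size (vars t) = leaves t.
Proof. by elim: t => //= t1 h1 t2 h2; rewrite size_cat h1 h2. Qed.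

Lemma vars_rename f t : vars (rename f t) = map f (vars t).
Proof. by elim: t => //= t1 h1 t2 h2; rewrite map_cat h1 h2. Qed.

Lemma leaves_rename f t : leaves (rename f t) = leaves t.
Proof. by rewrite -!size_vars vars_rename size_map. Qed.

Lemma eval_rename (A : algebra) (v : nat -> A) f t :
  eval v (rename f t) = eval (v \o f) t.
Proof. by elim: t => //= t1 -> t2 ->. Qed.

Lemma eq_in_eval (A : algebra) (v v' : nat -> A) t :
  {in vars t, v =1 v'} -> eval v t = eval v' t.
Proof.
elim: t => /= [x|t1 h1 t2 h2|t1 h1 t2 h2] h; first by rewrite h ?inE.
- by rewrite h1 ?h2 // => x hx; apply: h; rewrite mem_cat hx ?orbT.
- by rewrite h1 ?h2 // => x hx; apply: h; rewrite mem_cat hx ?orbT.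
Qed.

(** * Identities of bounded size, finitely many up to renaming *)

(** The recursion is on depth, which is enough to reach every term with at most [d] leaves: both
    arguments of an operation have strictly fewer leaves than the whole. *)
Fixpoint terms_upto (k d : nat) : seq term :=
  if d is d'.+1 then
    let T := terms_upto k d' in
    map Var (iota 0 k) ++ List.map (fun p => Add p.1 p.2) (List.list_prod T T)
      ++ List.map (fun p => Mul p.1 p.2) (List.list_prod T T)
  else [::].

Lemma In_terms_upto k d t :
  leaves t <= d -> all (fun x => x < k) (vars t) -> List.In t (terms_upto k d).
Proof.
elim: d t => [|d IH] t; first by have := leaves_gt0 t; case: leaves.
rewrite /=; case: t => [x|t1 t2|t1 t2] /= hs hv; apply/List.in_app_iff.
- left; move: hv; rewrite andbT => hx.
  have := mem_iota 0 k x; rewrite /= add0n hx.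
  elim: (iota 0 k) => //= y s IHs; rewrite inE.
  by case/orP => [/eqP ->|/IHs]; [left|right].
- right; apply/List.in_app_iff; left.
  apply/List.in_map_iff; exists (t1, t2); split=> //.
  have := leaves_gt0 t1; have := leaves_gt0 t2.
  move: hv; rewrite all_cat => /andP[h1 h2] g2 g1.
  by apply: List.in_prod; apply: IH => //; lia.
- right; apply/List.in_app_iff; right.
  apply/List.in_map_iff; exists (t1, t2); split=> //.
  have := leaves_gt0 t1; have := leaves_gt0 t2.
  move: hv; rewrite all_cat => /andP[h1 h2] g2 g1.
  by apply: List.in_prod; apply: IH => //; lia.
Qed.

(** Excluded middle stands in for a decision procedure; it serves to select the valid identities
    from a finite list. *)
Lemma classical_filter (T : Type) (P : T -> Prop) (s : seq T) :
  exists s', forall x, List.In x s' <-> List.In x s /\ P x.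
Proof.
elim: s => [|y s [s' IH]]; first by exists [::] => x; split=> // -[].
have [hy|hy] := Classical_Prop.classic (P y).
- exists (y :: s') => x /=; rewrite IH; split.
    by case=> [<-|[]]; split; auto.
  by case=> -[]; auto.
- exists s' => x /=; rewrite IH; split; first by case; auto.
  by case=> -[<-|] //.
Qed.

(** An identity with at most [M] leaves has at most [M] variables, so it is a renaming of one whose
    variables are below [M]; the valid ones among these form a finite list. *)
Lemma bounded_identities_basis (A : algebra) (M : nat) :
  exists E, models A E /\
    forall e, satisfies A e -> leaves e.1 + leaves e.2 <= M -> follows_from E e.
Proof.
have [E hE] := classical_filter (satisfies A)
  (List.list_prod (terms_upto M M) (terms_upto M M)).
exists E; split=> [e /hE []//|[s t] hA /= hM B hB v /=].
(* [f] numbers the variables by their first position in [xs]; [nth 0 xs] undoes this on [xs]. *)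
pose xs := vars s ++ vars t; pose f x := index x xs.
have hsz : size xs <= M by rewrite size_cat !size_vars.
have hf x : x \in xs -> f x < M.
  by move=> hx; apply: leq_trans hsz; rewrite index_mem.
have hin : List.In (rename f s, rename f t) E.
  apply/hE; split.
    apply: List.in_prod; apply: In_terms_upto; rewrite ?leaves_rename; try lia.
    - rewrite vars_rename all_map; apply/allP => x hx /=.
      by apply: hf; rewrite mem_cat hx.
    - rewrite vars_rename all_map; apply/allP => x hx /=.
      by apply: hf; rewrite mem_cat hx orbT.
  by move=> v' /=; rewrite !eval_rename; apply: hA.
have /= := hB _ hin (v \o nth 0 xs); rewrite !eval_rename.
have hv x : x \in xs -> ((v \o nth 0 xs) \o f) x = v x.
  by move=> hx /=; rewrite nth_index.
rewrite (@eq_in_eval _ ((v \o nth 0 xs) \o f) v s); last first.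
  by move=> x hx; rewrite hv // mem_cat hx.
rewrite (@eq_in_eval _ ((v \o nth 0 xs) \o f) v t) // => x hx.
by rewrite hv // mem_cat hx orbT.
Qed.

(** * Words, and the expansion of a term into words *)

(* On the empty list the value is the junk term [Var 0]. *)
Fixpoint bigt (op : term -> term -> term) (s : seq term) : term :=
  match s with
  | [::] => Var 0
  | [:: t] => t
  | t :: s' => op t (bigt op s')
  end.

Definition word (u : seq nat) : term := bigt Mul (map Var u).

Lemma word_cons x (u : seq nat) :
  u != [::] -> word (x :: u) = Mul (Var x) (word u).
Proof. by case: u. Qed.

(** The words of a term, obtained by multiplying out with the distributive laws. They are never
    empty, so the junk value of [word] does not occur among them. *)
Fixpoint mons (t : term) : seq (seq nat) :=
  match t with
  | Var x => [:: [:: x]]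
  | Add t1 t2 => mons t1 ++ mons t2
  | Mul t1 t2 => [seq u1 ++ u2 | u1 <- mons t1, u2 <- mons t2]
  end.

Lemma mons_nil t : [::] \notin mons t.
Proof.
elim: t => //= t1 h1 t2 h2; first by rewrite mem_cat negb_or h1.
apply/negP => /allpairsP[[[|x u1] u2] /= [hu1 _ //]].
by rewrite hu1 in h1.
Qed.

Lemma mons_neq0 t : mons t != [::].
Proof.
elim: t => //= t1 + t2; first by case: (mons t1).
by case: (mons t1) => // u1 s1 _; case: (mons t2).
Qed.

Lemma mons_word (u : seq nat) : u != [::] -> mons (word u) = [:: u].
Proof.
elim: u => // x [|y u] // IH _.
by rewrite word_cons //= IH.
Qed.

Lemma mons_sum_words s :
  s != [::] -> [::] \notin s -> mons (bigt Add (map word s)) = s.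
Proof.
elim: s => // u [|u' s] IH _.
  by rewrite inE eq_sym => hu; rewrite /= mons_word.
rewrite inE negb_or eq_sym => /andP[hu hs].
have -> : bigt Add (map word [:: u, u' & s]) =
          Add (word u) (bigt Add (map word (u' :: s))) by [].
by rewrite [LHS]/= mons_word // IH.
Qed.

Lemma leaves_word (u : seq nat) : u != [::] -> leaves (word u) = size u.
Proof.
elim: u => // x [|y u] // IH _.
by rewrite word_cons //= IH.
Qed.

Lemma leaves_sum_words n (s : seq (seq nat)) : s != [::] ->
  (forall u, u \in s -> u != [::] /\ size u <= n) ->
  leaves (bigt Add (map word s)) <= size s * n.
Proof.
elim: s => // u [|u' s] IH _ h.
  by have [] := h u (mem_head _ _) => hu hn; rewrite /= leaves_word // mul1n.
have -> : bigt Add (map word [:: u, u' & s]) =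
          Add (word u) (bigt Add (map word (u' :: s))) by [].
have [hu hn] := h u (mem_head _ _).
rewrite [leaves _]/= leaves_word // [size _]/= mulSn leq_add //.
by apply: IH => // u0 hu0; apply: h; rewrite inE hu0 orbT.
Qed.

(** * Order and evaluation in commutative ai-semirings *)

(** In an ai-semiring this is the order of the additive semilattice, with sums as joins. *)
Definition ale (A : algebra) (x y : A) : Prop := aadd x y = y.

Definition comm_ai_semiring (A : algebra) : Prop :=
  is_ai_semiring A /\ commutative (@amul A).

Lemma ale_refl (A : algebra) : comm_ai_semiring A -> forall x : A, ale x x.
Proof. by case=> -[[_ _ h]] _ _ _ _ x; apply: h. Qed.

Lemma ale_trans (A : algebra) : comm_ai_semiring A ->
  forall x y z : A, ale x y -> ale y z -> ale x z.
Proof.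
case=> -[[aA _ _] _ _ _ _] x y z hxy hyz.
by rewrite /ale -hyz aA hxy.
Qed.

Lemma ale_antisym (A : algebra) : comm_ai_semiring A ->
  forall x y : A, ale x y -> ale y x -> x = y.
Proof.
by case=> -[[_ aC _] _ _ _ _] x y hxy hyx; rewrite -hxy aC.
Qed.

Lemma ale_addl (A : algebra) : comm_ai_semiring A ->
  forall x y : A, ale x (aadd x y).
Proof. by case=> -[[aA _ aI] _ _ _ _] x y; rewrite /ale aA aI. Qed.

Lemma ale_addr (A : algebra) : comm_ai_semiring A ->
  forall x y : A, ale y (aadd x y).
Proof.
move=> hA x y; case: (hA) => -[[_ aC _] _ _ _ _].
by rewrite aC; apply: ale_addl.
Qed.

Lemma ale_lub (A : algebra) : comm_ai_semiring A ->
  forall x y z : A, ale x z -> ale y z -> ale (aadd x y) z.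
Proof. by case=> -[[aA _ _] _ _ _ _] x y z hx hy; rewrite /ale -aA hy. Qed.

Lemma ale_mul (A : algebra) : comm_ai_semiring A ->
  forall x y x' y' : A, ale x x' -> ale y y' -> ale (amul x y) (amul x' y').
Proof.
move=> hA x y x' y' hx hy; case: (hA) => -[_ _ mDl mDr] _.
apply: (@ale_trans _ hA _ (amul x' y)); first by rewrite /ale -mDl hx.
by rewrite /ale -mDr hy.
Qed.

Lemma eval_word_cons (A : algebra) (v : nat -> A) x (u : seq nat) :
  u != [::] -> eval v (word (x :: u)) = amul (v x) (eval v (word u)).
Proof. by case: u. Qed.

Lemma eval_word_cat (A : algebra) (v : nat -> A) (u1 u2 : seq nat) :
  comm_ai_semiring A -> u1 != [::] -> u2 != [::] ->
  eval v (word (u1 ++ u2)) = amul (eval v (word u1)) (eval v (word u2)).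
Proof.
move=> [[_ mA _ _] _] + h2.
elim: u1 => // x [|y u] IH _; first exact: eval_word_cons.
by rewrite cat_cons eval_word_cons // IH // (eval_word_cons v x) // mA.
Qed.

Lemma eval_word_map (A : algebra) (v : nat -> A) f (u : seq nat) : u != [::] ->
  eval v (word (map f u)) = eval (v \o f) (word u).
Proof.
elim: u => // x [|y u] IH _ //.
by rewrite map_cons (eval_word_cons v) // IH.
Qed.

Lemma vars_word (u : seq nat) : u != [::] -> vars (word u) = u.
Proof.
elim: u => // x [|y u] // IH _.
by rewrite word_cons //= IH.
Qed.

Lemma ale_eval (A : algebra) (v v' : nat -> A) t : comm_ai_semiring A ->
  (forall x, ale (v x) (v' x)) -> ale (eval v t) (eval v' t).
Proof.
move=> hA hv; elim: t => //= t1 h1 t2 h2; last exact: ale_mul.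
apply: ale_lub => //; first exact: ale_trans (ale_addl hA _ _).
exact: ale_trans (ale_addr hA _ _).
Qed.

Lemma ale_mons (A : algebra) (v : nat -> A) t u : comm_ai_semiring A ->
  u \in mons t -> ale (eval v (word u)) (eval v t).
Proof.
move=> hA; elim: t u => /= [x|t1 h1 t2 h2|t1 h1 t2 h2] u.
- by rewrite inE => /eqP ->; apply: ale_refl.
- rewrite mem_cat => /orP[/h1 h|/h2 h]; apply: (ale_trans hA h).
    exact: ale_addl.
  exact: ale_addr.
- case/allpairsP => -[u1 u2] /= [hu1 hu2 ->].
  have n1 : u1 != [::] by apply: contraNneq (mons_nil t1) => <-.
  have n2 : u2 != [::] by apply: contraNneq (mons_nil t2) => <-.
  by rewrite eval_word_cat //; apply: ale_mul; auto.
Qed.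

(* The extra factor [c] makes the induction go through products, as no
   residuation is available. *)
Lemma mons_lub_mul (A : algebra) (v : nat -> A) t c b : comm_ai_semiring A ->
  (forall u, u \in mons t -> ale (amul (eval v (word u)) c) b) ->
  ale (amul (eval v t) c) b.
Proof.
move=> hA; case: (hA) => -[_ mA mDl _] mC.
elim: t c => /= [x|t1 h1 t2 h2|t1 h1 t2 h2] c h.
- by apply: (h [:: x]); rewrite inE.
- rewrite mDl; apply: ale_lub => //.
    by apply: h1 => u hu; apply: h; rewrite mem_cat hu.
  by apply: h2 => u hu; apply: h; rewrite mem_cat hu orbT.
- rewrite -mA; apply: h1 => u1 hu1.
  rewrite mA [amul (eval v (word u1)) _]mC -mA; apply: h2 => u2 hu2.
  have n1 : u1 != [::] by apply: contraNneq (mons_nil t1) => <-.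
  have n2 : u2 != [::] by apply: contraNneq (mons_nil t2) => <-.
  rewrite mA [amul (eval v (word u2)) _]mC -eval_word_cat //.
  by apply: h; apply: allpairs_f.
Qed.

(** Together with [ale_mons], this makes the value of [t] the join of the values of its words.
    Without a unit the extra factor cannot be specialised away, so a product takes each of its two
    factors in turn as the extra factor for the other. *)
Lemma mons_lub (A : algebra) (v : nat -> A) t b : comm_ai_semiring A ->
  (forall u, u \in mons t -> ale (eval v (word u)) b) -> ale (eval v t) b.
Proof.
move=> hA; case: (hA) => -[_ mA _ _] mC.
elim: t => /= [x|t1 h1 t2 h2|t1 _ t2 _] h.
- by apply: (h [:: x]); rewrite inE.
- apply: ale_lub => //.
    by apply: h1 => u hu; apply: h; rewrite mem_cat hu.
  by apply: h2 => u hu; apply: h; rewrite mem_cat hu orbT.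
- apply: mons_lub_mul => // u1 hu1; rewrite mC.
  apply: mons_lub_mul => // u2 hu2.
  have n1 : u1 != [::] by apply: contraNneq (mons_nil t1) => <-.
  have n2 : u2 != [::] by apply: contraNneq (mons_nil t2) => <-.
  by rewrite mC -eval_word_cat //; apply: h; apply: allpairs_f.
Qed.

(** * Order and values of words in S_c^*(a^n) *)

Lemma Sc_star_comm n : comm_ai_semiring (Sc_star n).
Proof.
split; first exact: Sc_star_ai_semiring.
by move=> x y; apply: sc_nat_inj; rewrite /= !sc_nat_mul; lia.
Qed.

Lemma ale_sc_nat n (x y : Sc_star n) : ale x y <-> sc_nat x <= sc_nat y.
Proof.
split=> [h|h]; last by apply: sc_nat_inj; rewrite /= sc_nat_add; lia.
by rewrite -h /= sc_nat_add; lia.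
Qed.

Lemma sc_nat_le n (x : sc_carrier n) : sc_nat x <= n.
Proof. by case: x => //= i; apply: ltnW. Qed.

Lemma sc_nat_amul n (x y : Sc_star n) :
  sc_nat (amul x y) = minn n (sc_nat x + sc_nat y).+1.
Proof. exact: sc_nat_mul. Qed.

(** [sc_nat] is the exponent minus one, with 0 counted as exponent n+1, and every letter contributes
    at least 1 to the exponent. *)
Lemma sc_nat_word_ge n (v : nat -> Sc_star n) (u : seq nat) : u != [::] ->
  minn n (size u).-1 <= sc_nat (eval v (word u)).
Proof.
elim: u => // x [|y u] IH _; first by rewrite /= minn0.
by rewrite eval_word_cons // sc_nat_amul; have /= := IH isT; lia.
Qed.

Lemma sc_nat_word_const n (a : Sc_star n) (u : seq nat) :
  sc_nat a = 0 -> u != [::] ->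
  sc_nat (eval (fun=> a) (word u)) <= (size u).-1.
Proof.
move=> ha; elim: u => // x [|y u] IH _; first by rewrite /= ha.
by rewrite eval_word_cons // sc_nat_amul ha; have /= := IH isT; lia.
Qed.

Lemma Sc_star_word_top n (v : nat -> Sc_star n) (u : seq nat) y : n < size u ->
  ale y (eval v (word u)).
Proof.
move=> hu; apply/ale_sc_nat; have hn0 : u != [::] by case: u hu.
apply: leq_trans (sc_nat_le y) (leq_trans _ (sc_nat_word_ge v hn0)); lia.
Qed.

(** * A finite choice of representatives *)

Lemma key_representatives (T : eqType) (K : finType) (k : T -> K) (s : seq T) :
  exists s', [/\ {subset s' <= s}, size s' <= #|K|
    & forall x, x \in s -> exists2 y, y \in s' & k y = k x].
Proof.
case: s => [|x0 s]; first by exists [::].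
set l := x0 :: s; pose r c := nth x0 l (index c (map k l)).
have hr c : c \in map k l -> r c \in l /\ k (r c) = c.
  move=> hc; have hi : index c (map k l) < size l.
    by rewrite -(size_map k) index_mem.
  by split; [apply: mem_nth | rewrite -(nth_map x0 c k hi) nth_index].
exists (map r (undup (map k l))); split.
- by move=> y /mapP[c]; rewrite mem_undup => /hr[hc _] ->.
- by rewrite size_map -(card_uniqP (undup_uniq _)) max_card.
- move=> x hx; have hk : k x \in map k l by apply: map_f.
  by exists (r (k x)); [apply: map_f; rewrite mem_undup | have [] := hr _ hk].
Qed.

(** * Algebras satisfying all valid identities of bounded size *)

(** An inequality s <= t is the identity s + t = t, so [t] counts twice. The bound leaves room for a
    word of length at most n below a sum of one such word per pattern, for a variable below a word
    of length n+1, and, through the 10, for the commutative ai-semiring laws. *)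
Definition size_bound (n : nat) : nat :=
  2 * (#|{: n.-bseq 'I_n.+1}| + 2) * n.+1 + 10.

Definition satisfies_bounded (n : nat) (B : algebra) : Prop :=
  forall e, satisfies (Sc_star n) e ->
  leaves e.1 + leaves e.2 <= size_bound n -> satisfies B e.

Lemma satisfies_bounded_comm n B : satisfies_bounded n B -> comm_ai_semiring B.
Proof.
move=> hB; have [[[aA aC aI] mA mDl mDr] mC] := Sc_star_comm n.
(* Variables 0, 1, 2 stand for the three arguments; laws in fewer variables repeat an argument. *)
pose v (x y z : B) i := if i is i'.+1 then if i' is 0 then y else z else x.
pose X := Var 0; pose Y := Var 1; pose Z := Var 2.
have H s t : (forall w : nat -> Sc_star n, eval w s = eval w t) ->
    leaves s + leaves t <= 10 ->
    forall x y z, eval (v x y z) s = eval (v x y z) t.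
  move=> h hs x y z; apply: (hB (s, t)) => //=.
  by rewrite /size_bound; lia.
split; first split; first split.
- move=> x y z; apply: (H (Add X (Add Y Z)) (Add (Add X Y) Z)) => // w.
  exact: aA.
- by move=> x y; apply: (H (Add X Y) (Add Y X) _ _ x y x) => // w; apply: aC.
- by move=> x; apply: (H (Add X X) X _ _ x x x) => // w; apply: aI.
- move=> x y z; apply: (H (Mul X (Mul Y Z)) (Mul (Mul X Y) Z)) => // w.
  exact: mA.
- move=> x y z.
  by apply: (H (Mul (Add X Y) Z) (Add (Mul X Z) (Mul Y Z))) => // w; apply: mDl.
- move=> x y z.
  by apply: (H (Mul X (Add Y Z)) (Add (Mul X Y) (Mul X Z))) => // w; apply: mDr.
- by move=> x y; apply: (H (Mul X Y) (Mul Y X) _ _ x y x) => // w; apply: mC.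
Qed.

Lemma bounded_ale n (B : algebra) s t : satisfies_bounded n B ->
  (forall v : nat -> Sc_star n, ale (eval v s) (eval v t)) ->
  leaves s + 2 * leaves t <= size_bound n ->
  forall v : nat -> B, ale (eval v s) (eval v t).
Proof.
by move=> hB h hs v; apply: (hB (Add s t, t)) => //=; lia.
Qed.

(** For length exactly n+1 the claim is itself a bounded valid inequality. Longer words reduce to it
    one letter at a time by the valid inequality y <= xy. *)
Lemma bounded_word_top n (B : algebra) (v : nat -> B) (u : seq nat) y :
  satisfies_bounded n B -> n < size u -> ale y (eval v (word u)).
Proof.
move=> hB; have hC := satisfies_bounded_comm hB.
elim: u => // x u IH; rewrite /= ltnS leq_eqVlt => /orP[/eqP hn|hu]; last first.
  have nu : u != [::] by case: u hu {IH}.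
  rewrite eval_word_cons //; apply: (ale_trans hC (IH hu)).
  pose v' i := if i is 0 then v x else eval v (word u).
  apply: (bounded_ale (s := Var 1) (t := Mul (Var 0) (Var 1)) hB _ _ v') => /=.
    move=> w; apply/ale_sc_nat; have := sc_nat_le (w 1).
    by rewrite /= sc_nat_mul; lia.
  by rewrite /size_bound; lia.
(* Shifting the letters by one frees variable 0 for [y]. *)
pose v' i := if i is i'.+1 then v i' else y.
have E : eval v (word (x :: u)) = eval v' (word (map S (x :: u))).
  by rewrite eval_word_map //; apply: eq_in_eval.
rewrite E; apply: (bounded_ale (s := Var 0) hB _ _ v').
  by move=> w; apply: Sc_star_word_top; rewrite size_map /= -hn.
by rewrite leaves_word // size_map /= -hn /size_bound; lia.
Qed.

(** * Reduction of word inequalities to bounded size *)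

(** With a in place of every variable, [t] takes a value at most a^n, the element [b], whereas a
    word of more than n letters takes the value 0. *)
Lemma Sc_star_word_size n (w : seq nat) t : 0 < n -> w != [::] ->
  (forall u, u \in mons t -> size u <= n) ->
  (forall v : nat -> Sc_star n, ale (eval v (word w)) (eval v t)) ->
  size w <= n.
Proof.
move=> hn nw ht h; pose a : Sc_star n := Some (Ordinal hn).
have hn' : n.-1 < n by rewrite prednK.
pose b : Sc_star n := Some (Ordinal hn').
have hb : ale (eval (fun=> a) t) b.
  apply: mons_lub => [|u hu]; first exact: Sc_star_comm.
  have nu : u != [::] by apply: contraNneq (mons_nil t) => <-.
  have ha : sc_nat a = 0 by [].
  apply/ale_sc_nat; apply: leq_trans (sc_nat_word_const ha nu) _.
  by have := ht u hu; rewrite /=; lia.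
have /ale_sc_nat hle := ale_trans (Sc_star_comm n) (h (fun=> a)) hb.
by have := leq_trans (sc_nat_word_ge (fun=> a) nw) hle; rewrite /=; lia.
Qed.

(** Letters outside [w] all get index [size w], hence n+1 possible values when [w] has at most n
    letters. For longer [w] or [u] default values may intervene, so [pattern_inj] bounds the
    lengths. *)
Definition pattern n (w u : seq nat) : n.-bseq 'I_n.+1 :=
  insub_bseq n [seq inord (index x w) | x <- u].

Lemma pattern_inj n (w u u' : seq nat) :
  size w <= n -> size u <= n -> size u' <= n ->
  pattern n w u = pattern n w u' ->
  [seq index x w | x <- u] = [seq index x w | x <- u'].
Proof.
move=> hw hu hu' /(congr1 val).
rewrite /pattern !val_insubd !size_map hu hu' => /(congr1 (map val)).
rewrite -!map_comp.
have E s : map (val \o (fun x => inord (index x w) : 'I_n.+1)) s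
         = [seq index x w | x <- s].
  apply: eq_map => x /=; rewrite inordK // ltnS.
  exact: leq_trans (index_size _ _) hw.
by rewrite !E.
Qed.

Lemma bounded_word_ale n (B : algebra) (w : seq nat) t :
  0 < n -> satisfies_bounded n B -> w != [::] ->
  (forall v : nat -> Sc_star n, ale (eval v (word w)) (eval v t)) ->
  forall v : nat -> B, ale (eval v (word w)) (eval v t).
Proof.
move=> hn hB nw h v; have hC := satisfies_bounded_comm hB.
have hS := Sc_star_comm n.
(* A word of [t] longer than n already dominates every element of [B]. *)
have [/hasP[u hu hun]|] := boolP (has (fun u => n < size u) (mons t)).
  apply: (ale_trans hC _ (ale_mons v hC hu)).
  exact: bounded_word_top hB hun.
move=> /hasPn ht0; have ht u : u \in mons t -> size u <= n.
  by move=> hu; rewrite leqNgt ht0.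
have hw := Sc_star_word_size hn nw ht h.
have [l [l_sub l_size l_rep]] := key_representatives (pattern n w) (mons t).
have nl : l != [::].
  have := mons_neq0 t; case E: (mons t) => [//|u s] _.
  have [|y hy _] := l_rep u; first by rewrite E mem_head.
  by apply: contraTneq hy => ->.
have l_nil : [::] \notin l by apply: contra (mons_nil t); apply: l_sub.
pose t' := bigt Add (map word l).
have mt' : mons t' = l by apply: mons_sum_words.
(* Dropping words lowers a sum in [B], so it suffices to bound [w] by the short term [t']. *)
have tt' : ale (eval v t') (eval v t).
  by apply: mons_lub => // u; rewrite mt' => /l_sub; apply: ale_mons.
apply: (ale_trans hC _ tt').
apply: (bounded_ale hB _ _ v) => {v tt'}; last first.
  have : leaves t' <= size l * n.
    apply: leaves_sum_words => // u hu; split; last exact/ht/l_sub.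
    by apply: contraNneq l_nil => <-.
  have : size l * n <= #|{: n.-bseq 'I_n.+1}| * n.
    by rewrite leq_mul2r l_size orbT.
  by rewrite leaves_word // /size_bound; lia.
move=> v; pose a : Sc_star n := Some (Ordinal hn).
(* [v'] agrees with [v] on [w] and is the least element a elsewhere. It factors through the index in
   [w], so words with equal patterns take equal values. *)
pose g i := if i < size w then v (nth 0 w i) else a.
pose v' := g \o index^~ w.
have v'w x : x \in w -> v' x = v x.
  by move=> hx; rewrite /v' /g /= index_mem hx nth_index.
have v'v x : ale (v' x) (v x).
  have [/v'w ->|hx] := boolP (x \in w); first exact: ale_refl.
  by rewrite /v' /g /= index_mem (negPf hx); apply/ale_sc_nat.
have -> : eval v (word w) = eval v' (word w).
  by apply: eq_in_eval => x; rewrite vars_word // => /v'w.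
apply: (ale_trans hS (h v')); apply: mons_lub => // u hu.
have [u' hu' E] := l_rep u hu.
have nu : u != [::] by apply: contraNneq (mons_nil t) => <-.
have nu' : u' != [::] by apply: contraNneq l_nil => <-.
have Em := pattern_inj hw (ht _ (l_sub _ hu')) (ht _ hu) E.
(* Under [v'] the word [u] is replaced by its representative [u'], a word of [t']; then [v'] is
   raised to [v]. *)
rewrite -eval_word_map // -Em eval_word_map //.
apply: (ale_trans hS (ale_eval _ hS v'v)).
by apply: ale_mons; rewrite ?mt'.
Qed.

(** * From words to terms and identities *)

(** Each word of [s] lies below [s], hence below [t], in S_c^*(a^n); the word case carries this to
    [B], where [s] is the join of its words. *)
Lemma bounded_term_ale n (B : algebra) s t : 0 < n -> satisfies_bounded n B ->
  (forall v : nat -> Sc_star n, ale (eval v s) (eval v t)) ->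
  forall v : nat -> B, ale (eval v s) (eval v t).
Proof.
move=> hn hB h v; apply: mons_lub => [|u hu].
  exact: satisfies_bounded_comm hB.
apply: (bounded_word_ale hn hB) => [|v'].
  by apply: contraNneq (mons_nil s) => <-.
have hS := Sc_star_comm n.
exact: (ale_trans hS (ale_mons v' hS hu)).
Qed.

Theorem theorem4p2 (n : nat) (hn : 1 <= n) : finitely_based (Sc_star n).
Proof.
have [E [hE hb]] := bounded_identities_basis (Sc_star n) (size_bound n).
exists E; split=> // -[s t] hst B hB v.
have hBb : satisfies_bounded n B by move=> e he hs; apply: hb.
have hS := Sc_star_comm n.
(* An identity is a pair of opposite inequalities, both valid in S_c^*(a^n). *)
apply: (ale_antisym (satisfies_bounded_comm hBb)).
- by apply: (bounded_term_ale hn hBb) => v'; rewrite (hst v'); apply: ale_refl.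
- by apply: (bounded_term_ale hn hBb) => v'; rewrite -(hst v'); apply: ale_refl.
Qed.
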